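(* Let $n$ be a positive integer and let $a(n)$ be the number of Anosov graphs on $n$ vertices (up to isomorphism). For $j\ge 1$ let $\Lambda_j(n)=\{\lambda:\lambda\vdash n \text{ and } \lambda_{\ell(\lambda)}\ge j\}$ be the set of partitions of $n$ all of whose parts are at least $j$. Then $$\frac{1}{2}\sum_{\lambda\in\Lambda_3(n)} X(\ell(\lambda))\le a(n)\le \sum_{\lambda\in\Lambda_2(n)} \frac{\ell(\lambda)!}{\prod_{i=1}^{\lambda_1} k(\lambda,i)!}\,X(\ell(\lambda)),$$ where $k(\lambda,i)=|\{j:\lambda_j=i\}|$ is the number of parts of $\lambda$ equal to $i$.
   Context: A partition $\lambda=(\lambda_1,\dots,\lambda_k)$ of $n$ (written $\lambda\vdash n$) is a nonincreasing tuple of positive integers with sum $n$; its length is $\ell(\lambda)=k$. For a positive integer $t$, $X(t)$ is the number of $t\times t$ symmetric matrices with entries in $\{0,1\}$ in which no two rows are equal, counted up to graph equivalence: two such matrices are identified if they are adjacency matrices of isomorphic graphs (loops allowed), i.e. if one is obtained from the other by applying the same permutation to rows and columns. A simple graph is a finite undirected graph $G=(V,E)$ without loops or multiple edges. For $x\in V$ let $N(x)=\{y\in V: xy\in E\}$ and $\overline{N}(x)=N(x)\cup\{x\}$. Write $x\sim y$ if $N(x)=N(y)$ or $\overline{N}(x)=\overline{N}(y)$; this is an equivalence relation on $V$. A connected simple graph $G$ is called Anosov if (1) every $\sim$-equivalence class has at least $2$ elements, and (2) every $\sim$-equivalence class with exactly $2$ elements is edgeless, i.e. its two vertices are not adjacent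 in $G$. *)

(* Defs.v *)
From HB Require Import structures.
From mathcomp Require Import all_boot all_order all_fingroup all_algebra.

Set Implicit Arguments.
Unset Strict Implicit.
Unset Printing Implicit Defensive.

(* Graphs with vertex set 'I_n are given by their adjacency matrix, with
   entries 0, 1 encoded as booleans (M x x = true being a loop at x). *)

Definition graph_iso (n : nat) (M N : 'M[bool]_n) : bool :=
  [exists s : 'S_n, N == row_perm s (col_perm s M)].

Lemma graph_isoP (n : nat) (M N : 'M[bool]_n) :
  reflect (exists s : 'S_n, forall i j, N i j = M (s i) (s j)) (graph_iso M N).
Proof.
apply: (iffP existsP) => -[s sP]; exists s; first by move=> i j; rewrite (eqP sP) !mxE.
by apply/eqP/matrixP => i j; rewrite !mxE sP.
Qed.

Lemma graph_iso_equiv (n : nat) : equivalence_rel (@graph_iso n).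
Proof.
have refl M : graph_iso M M by apply/graph_isoP; exists 1%g => i j; rewrite !perm1.
have sym M N : graph_iso M N -> graph_iso N M.
  move=> /graph_isoP[s sP]; apply/graph_isoP; exists s^-1%g => i j.
  by rewrite sP !permKV.
have trans M N P : graph_iso M N -> graph_iso N P -> graph_iso M P.
  move=> /graph_isoP[s sP] /graph_isoP[u uP]; apply/graph_isoP.
  by exists (u * s)%g => i j; rewrite uP sP !permM.
move=> M N P; split=> // MN; apply/idP/idP.
  by move=> MP; apply: trans MP; apply: sym.
by move=> NP; apply: trans NP.
Qed.

Definition num_iso_classes (n : nat) (A : {set 'M[bool]_n}) : nat :=
  #|equivalence_partition (@graph_iso n) A|.

Definition X (t : nat) : nat :=
  num_iso_classes
    [set M : 'M[bool]_t | (M^T%R == M) && injectiveb (fun i => row i M)].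

Section Anosov.
Variables (V : finType) (e : rel V).

Definition simple_graph : bool :=
  [forall x, ~~ e x x] && [forall x, forall y, e x y == e y x].

Definition connected_graph : bool := [forall x, forall y, connect e x y].

Definition nbhd (x : V) : {set V} := [set y | e x y].
Definition closed_nbhd (x : V) : {set V} := x |: nbhd x.

Definition twins : rel V :=
  [rel x y | (nbhd x == nbhd y) || (closed_nbhd x == closed_nbhd y)].

Definition twin_class (x : V) : {set V} := [set y | twins x y].

Definition anosov : bool :=
  [&& simple_graph, connected_graph,
      [forall x, 2 <= #|twin_class x|] &
      [forall x, (#|twin_class x| == 2) ==>
         [forall y in twin_class x, forall z in twin_class x, ~~ e y z]]].

End Anosov.

Definition num_anosov (n : nat) : nat :=
  num_iso_classes [set M : 'M[bool]_n | anosov (fun x y => M x y)].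

Definition is_partition (n : nat) (l : seq nat) : bool :=
  [&& sorted geq l, 0 \notin l & sumn l == n].

(* A partition of n has at most n parts, all at most n, so the sequences in
   n.-bseq 'I_n.+1 include all partitions of n; see mem_Lambda. *)
Definition Lambda (j n : nat) : seq (seq nat) :=
  [seq l <- codom (fun s : n.-bseq 'I_n.+1 => [seq val i | i <- s])
     | is_partition n l & j <= last 0 l].

Lemma mem_Lambda (j n : nat) (l : seq nat) :
  (l \in Lambda j n) = is_partition n l && (j <= last 0 l).
Proof.
rewrite mem_filter andb_idr // => /andP[/and3P[_ l0 /eqP ln] _].
have size_l : size l <= n.
  rewrite -ln; elim: l l0 {ln} => //= -[|x] l IHl; rewrite inE //= => /IHl h.
  by rewrite addSn ltnS (leq_trans h) ?leq_addl.
have le_l x : x \in l -> x < n.+1.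
  rewrite ltnS -ln; elim: l {l0 ln size_l} => //= y l IHl.
  rewrite inE => /predU1P[->|/IHl h]; first exact: leq_addr.
  by rewrite (leq_trans h) ?leq_addl.
have size_s : size (map inord l : seq 'I_n.+1) <= n by rewrite size_map.
apply/codomP; exists (Bseq size_s) => /=.
rewrite -map_comp -[LHS]map_id; apply/eq_in_map => x xl /=.
by rewrite inordK ?le_l.
Qed.

Lemma Lambda_uniq (j n : nat) : uniq (Lambda j n).
Proof.
apply/filter_uniq; rewrite map_inj_uniq ?enum_uniq // => s t.
by move=> /(inj_map val_inj) /val_inj.
Qed.

(* Main.v *)
Require Import Defs.
From mathcomp Require Import all_boot all_order all_fingroup all_algebra.

(** Collapsing each twin class of a graph to a point, with a loop when the
    class is a clique, gives a symmetric 0-1 matrix with distinct rows, the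
    pattern; the graph is recovered by blowing up the i-th point of the pattern
    to as many vertices as its class has. The sizes of the classes form a
    partition of n, the type of the graph, and the bounds hold type by type:
    the number a_l of Anosov graphs of type l, with t parts, is compared with
    X(t), and the inequalities are summed over l.

    Upper bound. All parts of the type of an Anosov graph are at least 2
    ([anosov_typed]). With the pattern fixed up to isomorphism, the graph is
    determined by which class size sits at which point of the pattern, that is
    by an arrangement of the parts of l ([leq_num_anosov_of_type]), and the
    number of arrangements is the multinomial coefficient
    ([size_permutations_multinomial]).

    Lower bound. Suppose that all parts of l are at least 3. A blow-up of a
    pattern along l is Anosov as soon as it is connected, its blocks are
    exactly its twin classes, and hence it determines the pattern up to
    isomorphism and also l ([blowup_iso_inv]). So a_l is at least the number of
    patterns with connected blow-ups. These are at least half of all patterns,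
    because a graph or its complement is connected and complementing a matrix
    with distinct rows keeps its rows distinct ([leq_X_connected]). *)

Set Implicit Arguments.
Unset Strict Implicit.
Unset Printing Implicit Defensive.

(** * Counting isomorphism classes *)

(** A canonical representative turns the classes into the image of a map, so
    that estimates on numbers of classes become estimates on images. *)
Definition canonical_form (n : nat) (M : 'M[bool]_n) : 'M[bool]_n :=
  odflt M [pick N | graph_iso M N].

Lemma graph_iso_refl n : reflexive (@graph_iso n).
Proof. by move=> M; case: (graph_iso_equiv M M M). Qed.

Lemma graph_iso_left_trans n : left_transitive (@graph_iso n).
Proof. by move=> M N MN P; case: (graph_iso_equiv M N P) => _; apply. Qed.

Lemma graph_iso_sym n : symmetric (@graph_iso n).
Proof.
by move=> M N; apply/idP/idP => /graph_iso_left_trans <-; apply: graph_iso_refl.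
Qed.

Lemma canonical_form_iso n (M : 'M[bool]_n) : graph_iso M (canonical_form M).
Proof.
by rewrite /canonical_form; case: pickP => //= _; apply: graph_iso_refl.
Qed.

Lemma canonical_formP n (M N : 'M[bool]_n) :
  reflect (canonical_form M = canonical_form N) (graph_iso M N).
Proof.
apply: (iffP idP) => [MN|eq_MN]; last first.
  rewrite (graph_iso_left_trans (canonical_form_iso M)) eq_MN graph_iso_sym.
  exact: canonical_form_iso.
rewrite /canonical_form (eq_pick (graph_iso_left_trans MN)).
by case: pickP => // /(_ N); rewrite graph_iso_refl.
Qed.

Lemma leq_card_imset_kernel (T S U : finType) (f : T -> S) (g : T -> U)
    (A : {set T}) :
  {in A &, forall x y, g x = g y -> f x = f y} -> #|f @: A| <= #|g @: A|.
Proof.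
move=> fg; (* [option] gives a value to the elements of U that are not in the image. *)
rewrite -(card_imset _ (@Some_inj _)).
pose h u := omap f [pick x in A | g x == u].
apply: leq_trans (leq_imset_card h _).
apply/subset_leq_card/subsetP => _ /imsetP[_ /imsetP[x xA ->] ->].
apply/imsetP; exists (g x); first exact: imset_f.
rewrite /h; case: pickP => [y /andP[yA /eqP gy]|/(_ x)]; last by rewrite xA eqxx.
by rewrite /= (fg y x).
Qed.

Lemma num_iso_classesE n (A : {set 'M[bool]_n}) :
  num_iso_classes A = #|@canonical_form n @: A|.
Proof.
apply/eqP; rewrite eqn_leq; apply/andP; split; apply: leq_card_imset_kernel.
  move=> M N MA NA /canonical_formP MN.
  by apply/setP => P; rewrite !inE (graph_iso_left_trans MN).
move=> M N MA NA /setP /(_ N); rewrite !inE NA graph_iso_refl.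
by move/canonical_formP.
Qed.

Lemma leq_num_iso_classes_inj m n (A : {set 'M[bool]_m}) (B : {set 'M[bool]_n})
    (h : 'M[bool]_m -> 'M[bool]_n) :
  {in A, forall M, h M \in B} ->
  {in A &, forall M N, graph_iso (h M) (h N) -> graph_iso M N} ->
  num_iso_classes A <= num_iso_classes B.
Proof.
move=> hB h_inj; rewrite !num_iso_classesE.
apply: (@leq_trans #|(@canonical_form n \o h) @: A|).
  apply: leq_card_imset_kernel => M N MA NA /canonical_formP hMN.
  exact/canonical_formP/h_inj.
rewrite imset_comp; apply/subset_leq_card/imsetS/subsetP => _ /imsetP[M MA ->].
exact: hB.
Qed.

(** The upper bound is proved with labels instead of a map defined on [A]: a
    graph may carry several labels, and the choice among them need not respect
    isomorphism. *)
Lemma leq_num_iso_classes_labels n (A : {set 'M[bool]_n}) (L : eqType)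
    (s : seq L) (labelled : 'M[bool]_n -> L -> bool) :
  {in A, forall M, exists2 a, a \in s & labelled M a} ->
  (forall a, {in A &, forall M N,
     labelled M a -> labelled N a -> graph_iso M N}) ->
  num_iso_classes A <= size s.
Proof.
move=> A_lab lab_iso; rewrite num_iso_classesE.
rewrite -(card_imset _ (@Some_inj _)).
pose h a := omap (@canonical_form n) [pick M in A | labelled M a].
rewrite -(size_map h); apply: leq_trans (card_size _).
apply/subset_leq_card/subsetP => _ /imsetP[_ /imsetP[M MA ->] ->].
have [a a_s Ma] := A_lab M MA.
apply/mapP; exists a => //; rewrite /h.
case: pickP => [N /andP[NA Na]|/(_ M)]; last by rewrite MA Ma.
by congr Some; apply/canonical_formP/(lab_iso a).
Qed.

Lemma num_iso_classesU n (A B : {set 'M[bool]_n}) :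
  num_iso_classes (A :|: B) <= num_iso_classes A + num_iso_classes B.
Proof.
by rewrite !num_iso_classesE imsetU -cardsUI leq_addr.
Qed.

Lemma leq_num_iso_classes_sum n (I : eqType) (s : seq I) (A : {set 'M[bool]_n})
    (B : I -> {set 'M[bool]_n}) :
  {in A, forall M, exists2 i, i \in s & M \in B i} ->
  num_iso_classes A <= \sum_(i <- s) num_iso_classes (B i).
Proof.
elim: s A => [|i s IHs] A coverA.
  rewrite num_iso_classesE [A](_ : _ = set0) ?imset0 ?cards0 //.
  by apply/setP => M; rewrite inE; apply/negP => /coverA[].
rewrite big_cons -{1}(setID A (B i)).
apply: (leq_trans (num_iso_classesU _ _)); apply: leq_add.
  by rewrite !num_iso_classesE subset_leq_card ?imsetS ?subsetIr.
apply: IHs => M /setDP[/coverA[j] + Mj MBi].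
rewrite inE => /predU1P[ji|js]; last by exists j.
by rewrite -ji Mj in MBi.
Qed.

Lemma sum_num_iso_classes_leq n (I : eqType) (s : seq I) (A : {set 'M[bool]_n})
    (B : I -> {set 'M[bool]_n}) :
  uniq s -> (forall i, B i \subset A) ->
  {in s &, forall i j M N, M \in B i -> N \in B j -> graph_iso M N -> i = j} ->
  \sum_(i <- s) num_iso_classes (B i) <= num_iso_classes A.
Proof.
move=> uniq_s sBA disjB; rewrite num_iso_classesE.
pose U (r : seq I) := \bigcup_(i <- r) (@canonical_form n @: B i).
suff <-: #|U s| = \sum_(i <- s) num_iso_classes (B i).
  apply/subset_leq_card; rewrite /U; elim/big_ind: _ => [|X Y|i _].
  - exact: sub0set.
  - by rewrite subUset => -> ->.
  - exact: imsetS.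
elim: s uniq_s disjB => [|i r IHr] /=; first by rewrite /U !big_nil cards0.
move=> /andP[i_r uniq_r] disjB.
rewrite /U !big_cons cardsU -/(U r) IHr ?num_iso_classesE //; last first.
  by move=> j k jr kr; apply: disjB; rewrite inE ?jr ?kr orbT.
rewrite [_ :&: U r](_ : _ = set0) ?cards0 ?subn0 //.
apply/setP => P; rewrite !inE; apply/negP => /andP[/imsetP[M MB ->]].
rewrite /U (big_nth i) big_mkord => /bigcupP[k _ /imsetP[N NB]].
have kr : nth i r k \in r by rewrite mem_nth.
move=> /canonical_formP MN; have ik : i = nth i r k.
  by apply: disjB MB NB MN; rewrite inE ?eqxx ?kr ?orbT.
by rewrite ik kr in i_r.
Qed.

(** * Twin classes *)

Section Twins.
Variables (V : finType) (e : rel V).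
Hypothesis e_simple : simple_graph e.

Lemma simple_irr x : e x x = false.
Proof. by case/andP: e_simple => /forallP/(_ x)/negbTE. Qed.

Lemma simple_sym : symmetric e.
Proof. by move=> x y; case/andP: e_simple => _ /forallP/(_ x)/forallP/(_ y)/eqP. Qed.

(** Both kinds of twins at once: two vertices are twins iff no third vertex
    tells them apart, and whether their open or their closed neighbourhoods
    agree then depends only on whether they are adjacent. *)
Lemma twinsP x y :
  reflect (forall z, z != x -> z != y -> e x z = e y z) (twins e x y).
Proof.
apply: (iffP orP) => [[/eqP/setP eq_nbhd z _ _|/eqP/setP eq_nbhd z zx zy]|xy].
- by have := eq_nbhd z; rewrite !inE.
- by have := eq_nbhd z; rewrite !inE (negbTE zx) (negbTE zy).
have e_yx := simple_sym y x.
case exy: (e x y) e_yx => e_yx; [right|left]; apply/eqP/setP => z; rewrite !inE.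
  case: (eqVneq z x) => [->|zx]; first by rewrite e_yx orbT.
  by case: (eqVneq z y) => [->|zy]; rewrite ?exy //= xy.
case: (eqVneq z x) => [->|zx]; first by rewrite simple_irr e_yx.
by case: (eqVneq z y) => [->|zy]; rewrite ?exy ?simple_irr //= xy.
Qed.

Lemma twins_refl : reflexive (twins e).
Proof. by move=> x; apply/twinsP. Qed.

Lemma twins_sym : symmetric (twins e).
Proof. by move=> x y; apply/twinsP/twinsP => xy z zx zy; rewrite xy. Qed.

Lemma twins_trans : transitive (twins e).
Proof.
move=> y x w /twinsP xy /twinsP yw; apply/twinsP => z zx zw.
case: (eqVneq x w) => [->//|xw].
case: (eqVneq z y) => [zy|zy]; last by rewrite xy // yw.
rewrite zy {z zy} in zx zw *.
(* The middle vertex y cannot separate x from w: going around the triangle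
   x, y, w, each edge is present iff the next one is. *)
have [xy' wx wy] : [/\ x != y, w != x & w != y] by rewrite !(eq_sym w) eq_sym.
by rewrite (simple_sym x) yw // (simple_sym w) xy // simple_sym.
Qed.

Lemma twin_class_eq x y : (twin_class e x == twin_class e y) = twins e x y.
Proof.
apply/eqP/idP => [/setP/(_ y)|xy]; first by rewrite !inE twins_refl.
apply/setP => z; rewrite !inE; apply/idP/idP; last exact: twins_trans.
by apply: twins_trans; rewrite twins_sym.
Qed.

(** This makes every simple graph a blow-up of the graph of its twin classes:
    each end of the edge can be moved within its class. *)
Lemma twins_edge x y x' y' :
  twins e x x' -> twins e y y' -> x != y -> e x' y' -> e x y.
Proof.
move=> xx' yy' xy e_xy'.
have x'y' : x' != y' by apply: contraTneq e_xy' => ->; rewrite simple_irr.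
have yx : y != x by rewrite eq_sym.
(* If x' = y, moving y' to y would produce a loop; but then x, y and y' are in
   one class, and y' can be moved to x instead. *)
case: (eqVneq x' y) => [x'y|x'y].
  have /twinsP xy' : twins e x y' by apply: twins_trans yy'; rewrite -x'y.
  by rewrite xy' // -x'y // simple_sym.
rewrite (twinsP x x' xx') 1?[y == x']eq_sym // simple_sym.
by rewrite (twinsP y y' yy') // simple_sym.
Qed.

End Twins.

(** * Blow-ups *)

(** Equal rows i and j would mean that the points i and j have the same
    neighbours and are both looped and adjacent, or both loopless and not
    adjacent, so that their blocks would merge into one twin class. *)
Definition twin_free (t : nat) : {set 'M[bool]_t} :=
  [set M : 'M[bool]_t | (M^T%R == M) && injectiveb (fun i => row i M)].

Definition blowup (n t : nat) (Q : 'M[bool]_t) (c : {ffun 'I_n -> 'I_t}) :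
    'M[bool]_n :=
  (\matrix_(x, y) ((x != y) && Q (c x) (c y)))%R.

Definition fiber (n t : nat) (c : {ffun 'I_n -> 'I_t}) (i : 'I_t) : {set 'I_n} :=
  [set x | c x == i].

Definition fiber_sizes (n t : nat) (c : {ffun 'I_n -> 'I_t}) : seq nat :=
  [seq #|fiber c i| | i <- enum 'I_t].

Lemma twin_free_sym t (Q : 'M[bool]_t) i j : Q \in twin_free t -> Q i j = Q j i.
Proof. by rewrite inE => /andP[/eqP/matrixP/(_ j i)]; rewrite mxE. Qed.

Lemma twin_free_inj t (Q : 'M[bool]_t) i j :
  Q \in twin_free t -> (forall k, Q i k = Q j k) -> i = j.
Proof.
rewrite inE => /andP[_ /injectiveP rowI] Qij; apply: rowI.
by apply/rowP => k; rewrite !mxE.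
Qed.

Lemma twin_free_iso t (Q Q' : 'M[bool]_t) :
  graph_iso Q Q' -> Q \in twin_free t -> Q' \in twin_free t.
Proof.
move=> /graph_isoP[s Q'E] Q_tf; rewrite inE; apply/andP; split.
  by apply/eqP/matrixP => i j; rewrite mxE !Q'E (twin_free_sym _ _ Q_tf).
apply/injectiveP => i j /rowP row_ij; apply: (@perm_inj _ s).
apply: (twin_free_inj Q_tf) => k.
by have := row_ij (s^-1%g k); rewrite !mxE !Q'E permKV.
Qed.

Lemma twin_free_compl t (Q : 'M[bool]_t) :
  (map_mx negb Q \in twin_free t) = (Q \in twin_free t).
Proof.
suff compl (P : 'M[bool]_t) :
    P \in twin_free t -> map_mx negb P \in twin_free t.
  apply/idP/idP => /compl //; rewrite [map_mx _ _](_ : _ = Q) //.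
  by apply/matrixP => i j; rewrite !mxE negbK.
move=> P_tf; rewrite inE; apply/andP; split.
  by apply/eqP/matrixP => i j; rewrite !mxE (twin_free_sym _ _ P_tf).
apply/injectiveP => i j /rowP row_ij; apply: (twin_free_inj P_tf) => k.
by have := row_ij k; rewrite !mxE => /negb_inj.
Qed.

Lemma size_fiber_sizes n t (c : {ffun 'I_n -> 'I_t}) : size (fiber_sizes c) = t.
Proof. by rewrite size_map size_enum_ord. Qed.

Lemma nth_fiber_sizes n t (c : {ffun 'I_n -> 'I_t}) (i : 'I_t) :
  nth 0 (fiber_sizes c) i = #|fiber c i|.
Proof. by rewrite (nth_map i) ?nth_ord_enum // size_enum_ord. Qed.

Lemma sumn_fiber_sizes n t (c : {ffun 'I_n -> 'I_t}) : sumn (fiber_sizes c) = n.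
Proof.
rewrite sumnE big_map big_enum -[RHS]card_ord -sum1_card.
rewrite [RHS](partition_big c predT) //=.
by apply: eq_bigr => i _; rewrite -sum1dep_card.
Qed.

Lemma coloring_with_sizes n (l : seq nat) :
  sumn l = n -> exists c : {ffun 'I_n -> 'I_(size l)}, fiber_sizes c = l.
Proof.
move=> sum_l; pose F (i : 'I_(size l)) : finType := 'I_(nth 0 l i).
pose T : finType := {i : 'I_(size l) & F i}.
have cardT : n = #|T|.
  rewrite card_tagged -sum_l; congr sumn.
  apply: (@eq_from_nth _ 0) => [|i il]; first by rewrite size_map size_enum_ord.
  rewrite (nth_map (Ordinal il)) ?size_enum_ord // card_ord.
  by rewrite (nth_enum_ord (Ordinal il)).
pose c := [ffun x => tag (enum_val (cast_ord cardT x))].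
exists c; apply: (@eq_from_nth _ 0) => [|i]; rewrite size_fiber_sizes // => il.
rewrite (nth_fiber_sizes c (Ordinal il)) /=.
pose f (y : F (Ordinal il)) : 'I_n :=
  cast_ord (esym cardT) (enum_rank (Tagged F y)).
have f_inj : injective f.
  move=> y z /cast_ord_inj/enum_rank_inj /eqP.
  by rewrite -tag_eqE /tag_eq /= eqxx /= tagged_asE => /eqP.
rewrite -[RHS]card_ord -[RHS](card_imset _ f_inj); apply: eq_card => x.
rewrite inE ffunE; apply/eqP/imsetP => [cx|[y _ ->]]; last first.
  by rewrite /f cast_ordKV enum_rankK.
have := enum_valK (cast_ord cardT x).
case: (enum_val _) cx => j y /= ji; move: y; rewrite ji => y xE.
by exists y => //; rewrite /f xE cast_ordK.
Qed.

Lemma eq_fiber_sizes_perm n t (c d : {ffun 'I_n -> 'I_t}) :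
  fiber_sizes c = fiber_sizes d -> exists p : 'S_n, forall x, c x = d (p x).
Proof.
move=> cd; have: perm_eq (mktuple c) (mktuple d).
  have count_fiber (f : {ffun 'I_n -> 'I_t}) i :
      count_mem i (mktuple f) = #|fiber f i|.
    rewrite /= count_map -[RHS]sum1dep_card -sum1_count big_enum_cond /=.
    by apply: eq_bigl => x.
  apply/allP => i _ /=; rewrite !count_fiber.
  by rewrite -nth_fiber_sizes cd nth_fiber_sizes.
case/tuple_permP => p pE; exists p => x.
by rewrite -[LHS](tnth_mktuple c) [mktuple c](val_inj pE) !tnth_mktuple.
Qed.

Lemma blowup_iso n t (Q : 'M[bool]_t) (c d : {ffun 'I_n -> 'I_t}) :
  fiber_sizes c = fiber_sizes d -> graph_iso (blowup Q c) (blowup Q d).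
Proof.
case/esym/eq_fiber_sizes_perm => p dc; apply/graph_isoP; exists p => x y.
by rewrite !mxE !dc (inj_eq perm_inj).
Qed.

(** The relabelling of the pattern is moved into the colouring; this permutes
    the blocks, so only the multiset of block sizes is preserved. *)
Lemma blowup_pattern_iso n t (Q Q' : 'M[bool]_t) (c : {ffun 'I_n -> 'I_t}) :
  graph_iso Q Q' -> exists2 d : {ffun 'I_n -> 'I_t},
    perm_eq (fiber_sizes d) (fiber_sizes c) & blowup Q c = blowup Q' d.
Proof.
move=> /graph_isoP[s Q'E]; exists [ffun x => (s^-1)%g (c x)]; last first.
  by apply/matrixP => x y; rewrite !mxE !ffunE !Q'E !permKV.
rewrite /fiber_sizes (eq_map (g := (fun i => #|fiber c i|) \o s)) => [|i].
  rewrite map_comp; apply/perm_map/uniq_perm; rewrite ?enum_uniq //.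
    by rewrite map_inj_uniq ?enum_uniq //; apply: perm_inj.
  move=> i; rewrite mem_enum; apply/mapP; exists (s^-1%g i); last by rewrite permKV.
  by rewrite mem_enum.
rewrite /=; apply: eq_card => x; rewrite !inE ffunE.
by apply/eqP/eqP => [<-|->]; rewrite ?permKV ?permK.
Qed.

Lemma blowup_simple n t (Q : 'M[bool]_t) (c : {ffun 'I_n -> 'I_t}) :
  Q \in twin_free t -> simple_graph (fun x y => blowup Q c x y).
Proof.
move=> Q_tf; apply/andP; split; first by apply/forallP => x; rewrite mxE eqxx.
apply/forallP => x; apply/forallP => y.
by rewrite !mxE (eq_sym x y) (twin_free_sym _ _ Q_tf).
Qed.

Lemma fiber_other n t (c : {ffun 'I_n -> 'I_t}) i x :
  1 < #|fiber c i| -> exists2 y, c y = i & y != x.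
Proof.
rewrite (cardsD1 x) => fib2.
have /card_gt0P[y] : 0 < #|fiber c i :\ x| by move: fib2; case: (x \in fiber c i) => [|/ltnW].
by rewrite !inE => /andP[yx /eqP cy]; exists y.
Qed.

(** Two rows of the pattern differ at some block, and a block of at least two
    vertices contains one, other than the two given vertices, that witnesses
    the difference. *)
Lemma blowup_twins n t (Q : 'M[bool]_t) (c : {ffun 'I_n -> 'I_t}) x y :
  Q \in twin_free t -> (forall i, 1 < #|fiber c i|) ->
  twins (fun x y => blowup Q c x y) x y = (c x == c y).
Proof.
move=> Q_tf fib2; apply/(twinsP (blowup_simple c Q_tf))/idP.
  move=> xy; apply: contraT => cxy; case/eqP: (cxy).
  apply: (twin_free_inj Q_tf) => k.
  have [z [cz zx zy]] : exists z, [/\ c z = k, z != x & z != y].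
    case: (eqVneq (c y) k) => [cyk|cyk].
      have [z cz zy] := fiber_other y (fib2 k); exists z; split=> //.
      by apply: contraNneq cxy => <-; rewrite cz cyk.
    have [z cz zx] := fiber_other x (fib2 k); exists z; split=> //.
    by apply: contraNneq cyk => <-; rewrite cz.
  by have := xy z zx zy; rewrite !mxE ![_ == z]eq_sym zx zy cz.
by move/eqP => cxy z zx zy; rewrite !mxE cxy ![_ == z]eq_sym zx zy.
Qed.

(** A blow-up determines its pattern and its block sizes: the blocks are the
    twin classes, so an isomorphism permutes blocks. *)
Lemma blowup_iso_inv n t t' (Q : 'M[bool]_t) (Q' : 'M[bool]_t')
    (c : {ffun 'I_n -> 'I_t}) (c' : {ffun 'I_n -> 'I_t'}) :
  Q \in twin_free t -> Q' \in twin_free t' ->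
  (forall i, 1 < #|fiber c i|) -> (forall i, 1 < #|fiber c' i|) ->
  graph_iso (blowup Q c) (blowup Q' c') ->
  exists s : 'I_t' -> 'I_t,
    [/\ injective s, forall j, exists i, j = s i,
        forall i j, Q' i j = Q (s i) (s j) &
        forall i, #|fiber c' i| = #|fiber c (s i)|].
Proof.
move=> Q_tf Q'_tf fib2 fib2' /graph_isoP[p pE].
have c_p x y : (c (p x) == c (p y)) = (c' x == c' y).
  rewrite -(blowup_twins x y Q'_tf fib2') -(blowup_twins _ _ Q_tf fib2).
  apply/(twinsP (blowup_simple c Q_tf))/(twinsP (blowup_simple c' Q'_tf)).
    by move=> xy z zx zy; rewrite !pE xy ?(inj_eq perm_inj).
  move=> xy z; rewrite -(permKV p z) !(inj_eq perm_inj) -!pE; exact: xy.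
have pick_fib i : exists x, c' x == i.
  by have /card_gt0P[x] := ltnW (fib2' i); rewrite inE; exists x.
pose s i := c (p (xchoose (pick_fib i))).
have sE x : c (p x) = s (c' x).
  by apply/eqP; rewrite c_p eq_sym (eqP (xchooseP (pick_fib _))).
have s_inj : injective s.
  move=> i j /eqP; rewrite c_p.
  by rewrite (eqP (xchooseP (pick_fib i))) (eqP (xchooseP (pick_fib j))) => /eqP.
exists s; split=> // [j|i j|i].
- have /card_gt0P[y] := ltnW (fib2 j); rewrite inE => /eqP <-.
  by exists (c' (p^-1%g y)); rewrite -sE permKV.
- have /eqP cx := xchooseP (pick_fib i); set x := xchoose _ in cx.
  have [y cy yx] := fiber_other x (fib2' j).
  have := pE x y; rewrite !mxE (inj_eq perm_inj) (eq_sym x) yx /=.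
  by rewrite !sE cx cy.
- rewrite -(card_preimset (fiber c (s i)) (@perm_inj _ p)).
  by apply: eq_card => x; rewrite !inE sE (inj_eq s_inj).
Qed.

Lemma blowup_iso_pattern n t (Q Q' : 'M[bool]_t) (c c' : {ffun 'I_n -> 'I_t}) :
  Q \in twin_free t -> Q' \in twin_free t ->
  (forall i, 1 < #|fiber c i|) -> (forall i, 1 < #|fiber c' i|) ->
  graph_iso (blowup Q c) (blowup Q' c') -> graph_iso Q Q'.
Proof.
move=> Q_tf Q'_tf fib2 fib2' /(blowup_iso_inv Q_tf Q'_tf fib2 fib2').
case=> s [s_inj _ sQ _]; apply/graph_isoP.
by exists (perm s_inj) => i j; rewrite !permE.
Qed.

Lemma blowup_iso_sizes n t t' (Q : 'M[bool]_t) (Q' : 'M[bool]_t')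
    (c : {ffun 'I_n -> 'I_t}) (c' : {ffun 'I_n -> 'I_t'}) :
  Q \in twin_free t -> Q' \in twin_free t' ->
  (forall i, 1 < #|fiber c i|) -> (forall i, 1 < #|fiber c' i|) ->
  graph_iso (blowup Q c) (blowup Q' c') ->
  perm_eq (fiber_sizes c) (fiber_sizes c').
Proof.
move=> Q_tf Q'_tf fib2 fib2' /(blowup_iso_inv Q_tf Q'_tf fib2 fib2').
case=> s [s_inj s_onto _ sc]; rewrite perm_sym.
rewrite /fiber_sizes (eq_map sc) (map_comp (fun i => #|fiber c i|) s).
apply/perm_map/uniq_perm; rewrite ?(map_inj_uniq s_inj) -?enumT ?enum_uniq // => j.
by have [i ->] := s_onto j; rewrite mem_map // !mem_enum.
Qed.

(** * Connected blow-ups *)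

(** A block without any neighbour, not even itself, is edgeless: it has to be
    excluded separately because a single vertex is connected whereas its
    loopless blow-ups to several vertices are not. *)
Definition connected_pattern (t : nat) (Q : 'M[bool]_t) : bool :=
  [forall i, exists j, Q i j] && connected_graph (fun i j => Q i j).

Lemma blowup_connected n t (Q : 'M[bool]_t) (c : {ffun 'I_n -> 'I_t}) :
  Q \in twin_free t -> (forall i, 1 < #|fiber c i|) -> connected_pattern Q ->
  connected_graph (fun x y => blowup Q c x y).
Proof.
move=> Q_tf fib2 /andP[/forallP Q_nbr /forallP Q_conn].
set e := (fun x y => _).
have edge x y : x != y -> Q (c x) (c y) -> connect e x y.
  by move=> xy Qxy; apply: connect1; rewrite /e mxE xy.
have lift i p x : path (fun i j => Q i j) i p -> c x = i ->
    exists2 y, c y = last i p & connect e x y.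
  elim: p i x => [|j p IHp] i x /=; first by exists x; rewrite ?connect0.
  move=> /andP[Qij pj] cx; have [y cy yx] := fiber_other x (fib2 j).
  have [z cz yz] := IHp j y pj cy; exists z => //.
  by apply: connect_trans yz; apply: edge; rewrite 1?eq_sym // cx cy.
have same_block x y : c x = c y -> connect e x y.
  move=> cxy; case: (eqVneq x y) => [->|xy]; first exact: connect0.
  have /existsP[k Qk] := Q_nbr (c x).
  case: (eqVneq (c x) k) => [cxk|cxk].
    by apply: edge => //; rewrite -cxy {2}cxk.
  have [z cz _] := fiber_other x (fib2 k).
  have zx : x != z by apply: contraNneq cxk => ->; rewrite cz.
  have zy : z != y by apply: contraNneq cxk => zy; rewrite cxy -zy cz.
  apply: (@connect_trans _ _ z); apply: edge; rewrite ?cz // -cxy.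
  by rewrite (twin_free_sym _ _ Q_tf).
apply/forallP => x; apply/forallP => y.
have /connectP[p pP cy] := forallP (Q_conn (c x)) (c y).
have [z cz xz] := lift _ _ _ pP erefl.
by apply: connect_trans xz _; apply: same_block; rewrite cz -cy.
Qed.

(** A graph or its complement is connected: if no walk leads from i to j, then
    every vertex outside the component of i is joined to i in the complement,
    and those inside it are joined to j. *)
Lemma connected_pattern_compl t (Q : 'M[bool]_t) :
  Q \in twin_free t -> ~~ connected_pattern Q ->
  connected_pattern (map_mx negb Q).
Proof.
move=> Q_tf; set Q' := map_mx negb Q.
have Q'_sym i j : Q' i j = Q' j i by rewrite !mxE (twin_free_sym _ _ Q_tf).
(* A vertex to which everything is connected suffices. *)
have hub h : (forall i, exists j, Q' i j) ->
    (forall i, connect (fun i j => Q' i j) h i) -> connected_pattern Q'.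
  move=> nbr hubP; apply/andP; split.
    by apply/forallP => i; apply/existsP/nbr.
  apply/forallP => i; apply/forallP => j; apply: connect_trans (hubP j).
  by rewrite (sym_connect_sym Q'_sym).
rewrite negb_and => /orP[/forallPn[i /existsPn Qi]|].
  apply: (hub i) => j; first by exists i; rewrite Q'_sym mxE Qi.
  by apply: connect1; rewrite mxE Qi.
move=> /forallPn[i /forallPn[j Qij]].
have out k l : connect (fun i j => Q i j) i k ->
    ~~ connect (fun i j => Q i j) i l -> Q' k l.
  move=> ik; apply: contraNT; rewrite mxE negbK => Qkl.
  by apply: connect_trans ik _; apply: connect1.
have Q'ij : Q' i j by apply: out => //; apply: connect0.
apply: (hub i) => k; case: (boolP (connect (fun i j => Q i j) i k)) => ik.
- by exists j; apply: out.
- by exists i; rewrite Q'_sym; apply: out => //; apply: connect0.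
- apply: (@connect_trans _ _ j); apply: connect1 => //.
  by rewrite Q'_sym; apply: out.
- by apply: connect1; apply: out => //; apply: connect0.
Qed.

(** Complementation embeds the patterns that are not connected into those that
    are. *)
Lemma leq_X_connected t :
  X t <= 2 * num_iso_classes [set Q in twin_free t | connected_pattern Q].
Proof.
rewrite -[X t]/(num_iso_classes (twin_free t)) setIdE; set C := [set Q | _].
rewrite -{1}(setID (twin_free t) C) mul2n -addnn.
apply: leq_trans (num_iso_classesU _ _) _; rewrite leq_add2l.
apply: (leq_num_iso_classes_inj (h := map_mx negb)) => [Q|Q Q' _ _].
  rewrite in_setD in_setI twin_free_compl !in_set => /andP[QC Q_tf].
  by rewrite Q_tf connected_pattern_compl // inE.
move=> /graph_isoP[s sP]; apply/graph_isoP; exists s => i j.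
by have := sP i j; rewrite !mxE => /negb_inj.
Qed.

(** Blocks of three vertices keep the condition on two-element classes from
    coming up: a looped point may be blown up to a triangle, not to an edge. *)
Lemma anosov_blowup n t (Q : 'M[bool]_t) (c : {ffun 'I_n -> 'I_t}) :
  Q \in twin_free t -> (forall i, 2 < #|fiber c i|) -> connected_pattern Q ->
  anosov (fun x y => blowup Q c x y).
Proof.
move=> Q_tf fib3 Q_conn.
have fib2 i : 1 < #|fiber c i| by apply: ltnW.
have class_size x : 2 < #|twin_class (fun x y => blowup Q c x y) x|.
  rewrite (leq_trans (fib3 (c x))) //; apply/subset_leq_card/subsetP => y.
  by rewrite in_set [y \in twin_class _ _]in_set blowup_twins // eq_sym.
apply/and4P; split; first exact: blowup_simple.
- exact: blowup_connected.
- by apply/forallP => x; apply: ltnW.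
- by apply/forallP => x; rewrite gtn_eqF.
Qed.

(** * Anosov graphs by type *)

(** Collapsing the twin classes to points, in the order of decreasing size. *)
Lemma simple_graph_blowup n (M : 'M[bool]_n) :
  simple_graph (fun x y => M x y) ->
  exists l (Q : 'M[bool]_(size l)) (c : {ffun 'I_n -> 'I_(size l)}),
    [/\ Q \in twin_free (size l), sorted geq l, fiber_sizes c = l,
        M = blowup Q c &
        forall i, exists x, fiber c i = twin_class (fun x y => M x y) x].
Proof.
move=> M_simple; set e := (fun x y => _) in M_simple *.
pose ord (C D : {set 'I_n}) := #|D| <= #|C|.
pose classes := sort ord (enum [set twin_class e x | x in 'I_n]).
have classesP C : reflect (exists x, C = twin_class e x) (C \in classes).
  rewrite mem_sort mem_enum.
  by apply: (iffP imsetP) => [[x _ ->]|[x ->]]; exists x.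
have uniq_classes : uniq classes by rewrite sort_uniq enum_uniq.
pose l := [seq #|C| | C : {set 'I_n} <- classes].
have lt_index x : index (twin_class e x) classes < size l.
  by rewrite size_map index_mem; apply/classesP; exists x.
pose c := [ffun x => Ordinal (lt_index x)].
have c_twins x y : (c x == c y) = twins e x y.
  rewrite -(twin_class_eq M_simple) !ffunE -val_eqE /=; apply/eqP/eqP => [|-> //].
  by apply: (index_inj set0); apply/classesP; [exists x|exists y].
have fiberE x : fiber c (c x) = twin_class e x.
  by apply/setP => y; rewrite in_set [RHS]in_set c_twins (twins_sym M_simple).
have c_onto i : exists2 x, c x = i & nth set0 classes i = twin_class e x.
  have il : i < size classes by rewrite -(size_map (fun C : {set 'I_n} => #|C|)).
  have /classesP[x xE] := mem_nth set0 il; exists x => //.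
  by apply: val_inj; rewrite ffunE /= -xE index_uniq.
pose Q : 'M[bool]_(size l) :=
  (\matrix_(i, j) [exists x, exists y, [&& c x == i, c y == j & e x y]])%R.
have QP x y : x != y -> Q (c x) (c y) = e x y.
  move=> xy; rewrite mxE; apply/existsP/idP => [[x' /existsP[y' /and3P[]]]|exy].
    rewrite (eq_sym (c x')) (eq_sym (c y')) !c_twins => xx' yy'.
    exact: (twins_edge M_simple xx' yy' xy).
  by exists x; apply/existsP; exists y; rewrite !eqxx.
have M_blowup : M = blowup Q c.
  apply/matrixP => x y; rewrite [RHS]mxE.
  by case: (eqVneq x y) => [->|/QP ->//]; apply: simple_irr.
exists l, Q, c; split=> //.
- rewrite inE; apply/andP; split.
    apply/eqP/matrixP => i j; rewrite !mxE.
    apply/existsP/existsP => [] [x /existsP[y /and3P[cx cy exy]]];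
    by exists y; apply/existsP; exists x; rewrite cx cy (simple_sym M_simple).
  apply/injectiveP => i j /rowP row_ij.
  have [[x cx _] [y cy _]] := (c_onto i, c_onto j); rewrite -cx -cy in row_ij *.
  apply/eqP; rewrite c_twins; apply/(twinsP M_simple) => z zx zy.
  rewrite eq_sym in zx; rewrite eq_sym in zy; rewrite -(QP x z zx) -(QP y z zy).
  by have := row_ij (c z); rewrite [LHS]mxE [RHS]mxE.
- by rewrite /l sorted_map; apply: sort_sorted => C D; apply: leq_total.
- apply: (@eq_from_nth _ 0) => [|i]; rewrite size_fiber_sizes // => il.
  have [x cx xE] := c_onto (Ordinal il).
  rewrite (nth_fiber_sizes c (Ordinal il)) -cx fiberE -xE /= (nth_map set0) //.
  by rewrite -(size_map (fun C : {set 'I_n} => #|C|)).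
- by move=> i; have [x <- _] := c_onto i; exists x.
Qed.

(** The type is encoded by a blow-up presentation rather than by the sizes of
    the twin classes, since this is the form in which both bounds use it; that
    it is well defined is [anosov_type_unique]. *)
Definition anosov_of_type (n : nat) (l : seq nat) : {set 'M[bool]_n} :=
  [set M : 'M[bool]_n | anosov (fun x y => M x y) &&
    [exists Q in twin_free (size l), exists c : {ffun 'I_n -> 'I_(size l)},
       (fiber_sizes c == l) && (M == blowup Q c)]].

Lemma anosov_of_typeP n l (M : 'M[bool]_n) :
  reflect (anosov (fun x y => M x y) /\
           exists Q (c : {ffun 'I_n -> 'I_(size l)}),
             [/\ Q \in twin_free (size l), fiber_sizes c = l & M = blowup Q c])
          (M \in anosov_of_type n l).
Proof.
rewrite [_ \in _]in_set; apply: (iffP andP) => -[M_anosov].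
  case/exists_inP => Q Q_tf /existsP[c /andP[/eqP cl /eqP ME]].
  by split=> //; exists Q, c.
case=> Q [c [Q_tf cl ME]]; split=> //; apply/exists_inP; exists Q => //.
by apply/existsP; exists c; rewrite cl ME !eqxx.
Qed.

Lemma LambdaP j n l : 0 < n ->
  reflect [/\ sorted geq l, sumn l = n, 0 \notin l & all (leq j) l]
          (l \in Lambda j n).
Proof.
move=> n_gt0; rewrite mem_Lambda /is_partition -!andbA.
apply: (iffP and4P) => [[l_sort l0 /eqP sum_l last_l]|[l_sort sum_l l0 /allP lj]].
  split=> //; apply/allP => x xl; apply: leq_trans last_l _.
  elim: l x l_sort xl {l0 sum_l} => // y l IHl x /= l_path.
  have := l_path; rewrite (path_sortedE (rev_trans leq_trans)) => /andP[/allP ly l_sort].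
  rewrite inE => /predU1P[->|xl].
    by have := mem_last y l; rewrite inE => /predU1P[->//|/ly].
  by case: l xl IHl l_sort {ly l_path} => // z l xl IHl l_sort; apply: IHl.
split=> //; first exact/eqP.
case: l sum_l lj {l_sort l0} => [sum_l|x l _ lj]; first by rewrite -sum_l in n_gt0.
by apply: lj; apply: mem_last.
Qed.

Lemma anosov_typed n (M : 'M[bool]_n) : 0 < n ->
  anosov (fun x y => M x y) ->
  exists2 l, l \in Lambda 2 n & M \in anosov_of_type n l.
Proof.
move=> n_gt0 M_anosov; have /and4P[M_simple _ /forallP class2 _] := M_anosov.
have [l [Q [c [Q_tf l_sort cl ME fiberE]]]] := simple_graph_blowup M_simple.
exists l; last by apply/anosov_of_typeP; split=> //; exists Q, c.
have l2 x : x \in l -> 2 <= x.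
  rewrite -cl => /mapP[i _ ->]; have [y ->] := fiberE i; exact: class2.
apply/LambdaP => //; split=> //; first by rewrite -cl sumn_fiber_sizes.
  by apply/negP => /l2.
exact/allP.
Qed.

(** * The two bounds for a given type *)

(** Induction on the first letter: the arrangements of [s] that start with [x]
    are those of [s] without one occurrence of [x]. They contribute
    [count_mem x s] times the factorial of [(size s).-1], and the counts of all
    letters add up to [size s]. *)
Lemma size_permutations_multinomial (T : eqType) (r s : seq T) :
  uniq r -> {subset s <= r} ->
  size (permutations s) * \prod_(x <- r) (count_mem x s)`! = (size s)`!.
Proof.
move=> uniq_r; have [m] := ubnP (size s); elim: m s => // m IHm s.
rewrite ltnS => le_sm sr.
have [s0|s_gt0] := posnP (size s).
  by rewrite (size0nil s0) big1.
rewrite (perm_size (permutationsE s_gt0)) size_allpairs_dep sumnE big_map.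
rewrite big_distrl /= (eq_big_seq (fun x => count_mem x s * (size s).-1`!)).
  rewrite -big_distrl /=; set k := (size s).-1`!.
  have -> : \sum_(x <- undup s) count_mem x s = size s.
    rewrite -[RHS]sum1_size -[RHS]big_undup_iterop_count; apply: eq_bigr => x _ /=.
    by elim: (count_mem x s) => //= -[|j] //= <-.
  by rewrite /k -[in RHS](prednK s_gt0) factS prednK.
move=> x; rewrite mem_undup => xs.
rewrite -[in RHS](size_rem xs) -(IHm (rem x s)); first last.
- by move=> y /mem_rem/sr.
- by rewrite size_rem // prednK.
rewrite mulnCA; congr (_ * _).
(* Only the factor of x changes: (count_mem x s)`! loses its last factor. *)
rewrite !(bigD1_seq x) ?sr //= mulnA; congr (_ * _); last first.
  by apply: eq_bigr => y yx; rewrite count_rem xs /= eq_sym (negbTE yx) subn0.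
have : 0 < count_mem x s by rewrite -has_count has_pred1.
by rewrite count_rem xs /= eqxx; case: (count_mem x s) => // j _; rewrite factS subn1.
Qed.

(** A label is an arrangement of the block sizes along a canonical pattern.
    Isomorphic patterns must share one representative here, because the
    arrangement refers to the order of its points. *)
Lemma leq_num_anosov_of_type n l :
  num_iso_classes (anosov_of_type n l) <= size (permutations l) * X (size l).
Proof.
pose patterns := enum [set canonical_form Q | Q in twin_free (size l)].
have sizeE : size (permutations l) * X (size l) =
             size [seq (w, Q) | w <- permutations l, Q <- patterns].
  by rewrite size_allpairs -cardE -num_iso_classesE.
pose labelled (M : 'M[bool]_n) (a : seq nat * 'M[bool]_(size l)) :=
  [exists c : {ffun 'I_n -> 'I_(size l)},
     (fiber_sizes c == a.1) && (M == blowup a.2 c)].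
rewrite sizeE; apply: (leq_num_iso_classes_labels (labelled := labelled)).
  move=> M /anosov_of_typeP[_ [Q [c [Q_tf cl ME]]]].
  have [d dc QE] := blowup_pattern_iso c (canonical_form_iso Q).
  exists (fiber_sizes d, canonical_form Q).
    apply: allpairs_f; last by rewrite mem_enum imset_f.
    by rewrite mem_permutations -[X in perm_eq _ X]cl.
  by apply/existsP; exists d; rewrite ME QE !eqxx.
move=> a M N _ _ /existsP[c /andP[/eqP ca /eqP ->]].
by move=> /existsP[d /andP[/eqP da /eqP ->]]; apply: blowup_iso; rewrite ca.
Qed.

Lemma X_leq_num_anosov_of_type n l : sumn l = n -> all (leq 3) l ->
  X (size l) <= 2 * num_iso_classes (anosov_of_type n l).
Proof.
move=> sum_l /allP l3; apply: leq_trans (leq_X_connected _) _.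
have [c cl] := coloring_with_sizes sum_l.
have fib3 i : 2 < #|fiber c i|.
  by rewrite -nth_fiber_sizes l3 // -[in X in _ \in X]cl mem_nth // size_fiber_sizes.
rewrite leq_mul2l /=; apply: (leq_num_iso_classes_inj (h := fun Q => blowup Q c)).
  move=> Q /setIdP[Q_tf Q_conn].
  by apply/anosov_of_typeP; split; [apply: anosov_blowup | exists Q, c].
move=> Q Q' /setIdP[Q_tf _] /setIdP[Q'_tf _].
by apply: blowup_iso_pattern => // i; apply: ltnW.
Qed.

(** As blocks of at least two vertices are twin classes, their sizes are
    invariant under isomorphism. *)
Lemma anosov_type_unique n j l l' (M N : 'M[bool]_n) : 0 < n -> 1 < j ->
  l \in Lambda j n -> l' \in Lambda j n ->
  M \in anosov_of_type n l -> N \in anosov_of_type n l' ->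
  graph_iso M N -> l = l'.
Proof.
move=> n_gt0 j2 /(LambdaP _ _ n_gt0)[l_sort _ _ /allP lj].
move=> /(LambdaP _ _ n_gt0)[l'_sort _ _ /allP l'j].
move=> /anosov_of_typeP[_ [Q [c [Q_tf cl ->]]]].
move=> /anosov_of_typeP[_ [Q' [c' [Q'_tf cl' ->]]]] iso.
have geq_anti : antisymmetric geq by move=> x y; rewrite andbC => /anti_leq.
apply: (sorted_eq (rev_trans leq_trans) geq_anti l_sort l'_sort).
rewrite -[X in perm_eq X _]cl -[X in perm_eq _ X]cl'.
apply: blowup_iso_sizes iso => // i; apply: leq_trans j2 _.
  by apply: lj; rewrite -nth_fiber_sizes -[X in _ \in X]cl mem_nth ?size_fiber_sizes.
by apply: l'j; rewrite -nth_fiber_sizes -[X in _ \in X]cl' mem_nth ?size_fiber_sizes.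
Qed.

Lemma num_anosov_ub n : 0 < n ->
  num_anosov n <= \sum_(l <- Lambda 2 n) size (permutations l) * X (size l).
Proof.
move=> n_gt0.
apply: (@leq_trans (\sum_(l <- Lambda 2 n) num_iso_classes (anosov_of_type n l))).
  by apply: leq_num_iso_classes_sum => M; rewrite inE => /(anosov_typed n_gt0).
by apply: leq_sum => l _; apply: leq_num_anosov_of_type.
Qed.

Lemma num_anosov_lb n : 0 < n ->
  \sum_(l <- Lambda 3 n) X (size l) <= 2 * num_anosov n.
Proof.
move=> n_gt0.
apply: (@leq_trans
          (2 * \sum_(l <- Lambda 3 n) num_iso_classes (anosov_of_type n l))).
  rewrite big_distrr /= big_seq [leqRHS]big_seq; apply: leq_sum => l.
  by case/(LambdaP _ _ n_gt0) => _ sum_l _ l3; apply: X_leq_num_anosov_of_type.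
rewrite leq_mul2l /=; apply: sum_num_iso_classes_leq (Lambda_uniq _ _) _ _.
  by move=> l; apply/subsetP => M; rewrite !in_set => /andP[].
by move=> l l' lL l'L M N; apply: (anosov_type_unique (j := 3)).
Qed.

Import Order.TTheory GRing.Theory Num.Theory.
Local Open Scope ring_scope.

Theorem theorem5p4 (n : nat) (n_gt0 : (0 < n)%N) :
  (1 / 2 * (\sum_(l <- Lambda 3 n) (X (size l))%:R) <= (num_anosov n)%:R :> rat)
  /\
  ((num_anosov n)%:R <=
     \sum_(l <- Lambda 2 n)
       ((size l)`!)%:R / (\prod_(1 <= i < (head 0%N l).+1) ((count_mem i l)`!)%:R)
         * (X (size l))%:R :> rat).
Proof.
split.
  rewrite -natr_sum mulrC mul1r ler_pdivrMr // -natrM ler_nat mulnC.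
  exact: num_anosov_lb.
apply: (@le_trans _ _
          (\sum_(l <- Lambda 2 n) (size (permutations l) * X (size l))%:R)).
  by rewrite -natr_sum ler_nat num_anosov_ub.
rewrite le_eqVlt; apply/orP; left; apply/eqP.
apply: eq_big_seq => l /(LambdaP _ _ n_gt0)[l_sort _ l0 _].
rewrite natrM -natr_prod; congr (_ * _).
set d := (\prod_(_ <= _ < _) _)%N.
have d_neq0 : d%:R != 0 :> rat.
  by rewrite pnatr_eq0 -lt0n prodn_gt0 // => i; apply: fact_gt0.
apply/(canRL (mulfK d_neq0)); rewrite -natrM /d /index_iota.
rewrite size_permutations_multinomial ?iota_uniq // => x xl.
rewrite mem_iota; apply/andP; split; first by case: x xl l0 => // ->.
rewrite subSS subn0 add1n ltnS; case: l xl l_sort {l0 d d_neq0} => //= y l.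
rewrite (path_sortedE (rev_trans leq_trans)) inE => /predU1P[-> //|xl].
by case/andP => /allP/(_ x xl).
Qed.
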